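(* Let $\mathbb{C}$ be a finitely complete and finitely cocomplete category. Then the class $\mathsf{NMono}(\mathbb{C})$ of normal monomorphisms of $\mathbb{C}$ is reflective in $\mathbb{C}$, and the class $\mathsf{NEpi}(\mathbb{C})$ of normal epimorphisms of $\mathbb{C}$ is coreflective in $\mathbb{C}$.
   Context: Let $1$ and $0$ denote the terminal and initial object of $\mathbb{C}$. For a morphism $f:A\to B$ in $\mathbb{C}$, form the pushout $B+_A1$ of $f$ along $A\to 1$, and let $N_f=B\times_{(B+_A1)}1$ be the pullback of the two pushout injections $B\to B+_A1\leftarrow 1$, with projection $\nu_f:N_f\to B$; let $\hat f:A\to N_f$ be the induced morphism with $\nu_f\cdot\hat f=f$. Dually, form the pullback $0\times_BA$ of $0\to B$ and $f$, and let $P_f=0+_{(0\times_BA)}A$ be the pushout of the two pullback projections $0\leftarrow 0\times_BA\to A$, with injection $\pi_f:A\to P_f$; let $\check f:P_f\to B$ be the induced morphism with $\check f\cdot\pi_f=f$. The morphism $f$ is a normal monomorphism if $\hat f$ is an isomorphism, and a normal epimorphism if $\check f$ is an isomorphism. $\mathsf{Arr}(\mathbb{C})$ is the category whose objects are the morphisms of $\mathbb{C}$ and whose morphisms $\langle u,v\rangle:f\to g$ are pairs of morphisms of $\mathbb{C}$ with $g\cdot u=v\cdot f$. A class $\mathcal{M}$ of morphisms of $\mathbb{C}$ is replete if it contains all identity morphisms and is closed under composition with isomorphisms from either side. A replete class $\mathcal{M}$ is reflective in $\mathbb{C}$ if the full subcategory of $\mathsf{Arr}(\mathbb{C})$ with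 object class $\mathcal{M}$ is reflective in $\mathsf{Arr}(\mathbb{C})$; a replete class is coreflective in $\mathbb{C}$ if it is a reflective class of $\mathbb{C}^{\mathrm{op}}$ (equivalently, if the corresponding full subcategory of $\mathsf{Arr}(\mathbb{C})$ is coreflective). *)

(* Defs.v *)
From Stdlib Require Import List FinFun ProofIrrelevance.

Set Implicit Arguments.
Unset Strict Implicit.
Unset Printing Implicit Defensive.

Record Category : Type := MkCategory {
  Ob :> Type;
  Hom : Ob -> Ob -> Type;
  idm : forall A, Hom A A;
  comp : forall A B D, Hom B D -> Hom A B -> Hom A D;
  comp_idl : forall A B (f : Hom A B), comp (idm B) f = f;
  comp_idr : forall A B (f : Hom A B), comp f (idm A) = f;
  comp_assoc : forall A B D E (h : Hom D E) (g : Hom B D) (f : Hom A B),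
      comp h (comp g f) = comp (comp h g) f
}.

Arguments Hom {c} A B.
Arguments idm {c} A.
Arguments comp {c A B D} g f.

Declare Scope cat_scope.
Delimit Scope cat_scope with cat.
Notation "g ∘ f" := (comp g f) (at level 40, left associativity) : cat_scope.
Local Open Scope cat_scope.

Definition op (C : Category) : Category :=
  {| Ob := Ob C;
     Hom := fun A B => @Hom C B A;
     idm := fun A => idm A;
     comp := fun A B D g f => f ∘ g;
     comp_idl := fun A B f => comp_idr f;
     comp_idr := fun A B f => comp_idl f;
     comp_assoc := fun A B D E h g f => eq_sym (comp_assoc f g h) |}.

Definition is_iso (C : Category) (A B : C) (f : Hom A B) : Prop :=
  exists g : Hom B A, g ∘ f = idm A /\ f ∘ g = idm B.

Record Functor (C D : Category) : Type := MkFunctor {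
  fobj :> C -> D;
  fmap : forall A B : C, Hom A B -> Hom (fobj A) (fobj B);
  fmap_id : forall A : C, fmap (idm A) = idm (fobj A);
  fmap_comp : forall (A B E : C) (g : Hom B E) (f : Hom A B),
      fmap (g ∘ f) = fmap g ∘ fmap f
}.

(* F is left adjoint to G. *)
Record Adjunction (C D : Category) (F : Functor C D) (G : Functor D C) : Type :=
MkAdjunction {
  adj_unit : forall X : C, Hom X (G (F X));
  adj_counit : forall Y : D, Hom (F (G Y)) Y;
  adj_unit_natural : forall (X X' : C) (u : Hom X X'),
      fmap G (fmap F u) ∘ adj_unit X = adj_unit X' ∘ u;
  adj_counit_natural : forall (Y Y' : D) (v : Hom Y Y'),
      v ∘ adj_counit Y = adj_counit Y' ∘ fmap F (fmap G v);
  triangle_left : forall X : C, adj_counit (F X) ∘ fmap F (adj_unit X) = idm (F X);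
  triangle_right : forall Y : D, fmap G (adj_counit Y) ∘ adj_unit (G Y) = idm (G Y)
}.

Definition has_left_adjoint (C D : Category) (G : Functor D C) : Prop :=
  exists F : Functor C D, inhabited (Adjunction F G).

Definition full_sub (C : Category) (P : C -> Prop) : Category :=
  {| Ob := {X : C | P X};
     Hom := fun X Y => @Hom C (proj1_sig X) (proj1_sig Y);
     idm := fun X => idm (proj1_sig X);
     comp := fun X Y Z g f => g ∘ f;
     comp_idl := fun X Y f => comp_idl f;
     comp_idr := fun X Y f => comp_idr f;
     comp_assoc := fun X Y Z W h g f => comp_assoc h g f |}.

Definition full_sub_incl (C : Category) (P : C -> Prop) : Functor (full_sub P) C :=
  {| fobj := fun X : full_sub P => proj1_sig X;
     fmap := fun X Y f => f;
     fmap_id := fun X => eq_refl;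
     fmap_comp := fun X Y Z g f => eq_refl |}.

Definition reflective_sub (C : Category) (P : C -> Prop) : Prop :=
  has_left_adjoint (full_sub_incl P).

Definition is_limit (J C : Category) (F : Functor J C)
    (L : C) (p : forall j : J, Hom L (F j)) : Prop :=
  (forall (i j : J) (a : Hom i j), fmap F a ∘ p i = p j) /\
  forall (X : C) (q : forall j : J, Hom X (F j)),
    (forall (i j : J) (a : Hom i j), fmap F a ∘ q i = q j) ->
    exists! h : Hom X L, forall j : J, p j ∘ h = q j.

Definition is_colimit (J C : Category) (F : Functor J C)
    (L : C) (p : forall j : J, Hom (F j) L) : Prop :=
  (forall (i j : J) (a : Hom i j), p j ∘ fmap F a = p i) /\
  forall (X : C) (q : forall j : J, Hom (F j) X),
    (forall (i j : J) (a : Hom i j), q j ∘ fmap F a = q i) ->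
    exists! h : Hom L X, forall j : J, h ∘ p j = q j.

Definition finite_category (J : Category) : Prop :=
  Finite J /\ forall i j : J, Finite (Hom i j).

Definition finitely_complete (C : Category) : Prop :=
  forall (J : Category) (F : Functor J C), finite_category J ->
    exists (L : C) (p : forall j : J, Hom L (F j)), is_limit p.

Definition finitely_cocomplete (C : Category) : Prop :=
  forall (J : Category) (F : Functor J C), finite_category J ->
    exists (L : C) (p : forall j : J, Hom (F j) L), is_colimit p.

Definition is_terminal (C : Category) (T : C) : Prop :=
  forall X : C, exists! t : Hom X T, True.

Definition is_initial (C : Category) (I : C) : Prop :=
  forall X : C, exists! t : Hom I X, True.

(* p : P -> X and q : P -> Y are the projections. *)
Definition is_pullback (C : Category) (X Y Z P : C)
    (f : Hom X Z) (g : Hom Y Z) (p : Hom P X) (q : Hom P Y) : Prop :=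
  f ∘ p = g ∘ q /\
  forall (W : C) (a : Hom W X) (b : Hom W Y), f ∘ a = g ∘ b ->
    exists! h : Hom W P, p ∘ h = a /\ q ∘ h = b.

(* i : X -> Q and j : Y -> Q are the injections. *)
Definition is_pushout (C : Category) (Z X Y Q : C)
    (f : Hom Z X) (g : Hom Z Y) (i : Hom X Q) (j : Hom Y Q) : Prop :=
  i ∘ f = j ∘ g /\
  forall (W : C) (a : Hom X W) (b : Hom Y W), a ∘ f = b ∘ g ->
    exists! h : Hom Q W, h ∘ i = a /\ h ∘ j = b.

(* (N, nu) is a choice of N_f with its projection to B; all choices are
   isomorphic over B.  Here T is 1 and Q is the pushout of f along A -> 1. *)
Definition is_normal_image (C : Category) (A B : C) (f : Hom A B)
    (N : C) (nu : Hom N B) : Prop :=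
  exists (T Q : C) (t : Hom A T) (i : Hom B Q) (j : Hom T Q) (s : Hom N T),
    is_terminal T /\ is_pushout f t i j /\ is_pullback i j nu s.

(* (P, pi) is a choice of P_f with its injection from A; all choices are
   isomorphic under A.  Here I is 0 and K is the pullback of 0 -> B and f. *)
Definition is_normal_coimage (C : Category) (A B : C) (f : Hom A B)
    (P : C) (pi : Hom A P) : Prop :=
  exists (I K : C) (z : Hom I B) (k : Hom K I) (l : Hom K A) (s : Hom I P),
    is_initial I /\ is_pullback z f k l /\ is_pushout k l s pi.

(* The equation nu ∘ fhat = f determines fhat: it is the morphism into the
   pullback with components f and A -> 1, the second being automatic. *)
Definition normal_mono (C : Category) (A B : C) (f : Hom A B) : Prop :=
  exists (N : C) (nu : Hom N B) (fhat : Hom A N),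
    is_normal_image f nu /\ nu ∘ fhat = f /\ is_iso fhat.

Definition normal_epi (C : Category) (A B : C) (f : Hom A B) : Prop :=
  exists (P : C) (pi : Hom A P) (fcheck : Hom P B),
    is_normal_coimage f pi /\ fcheck ∘ pi = f /\ is_iso fcheck.

Record arrow (C : Category) : Type := MkArrow {
  src : C;
  tgt : C;
  mor : Hom src tgt
}.

Record arrow_hom (C : Category) (f g : arrow C) : Type := MkArrowHom {
  top : Hom (src f) (src g);
  bot : Hom (tgt f) (tgt g);
  square : mor g ∘ top = bot ∘ mor f
}.

Lemma arrow_hom_eq (C : Category) (f g : arrow C) (a b : arrow_hom f g) :
  top a = top b -> bot a = bot b -> a = b.
Proof.
destruct a as [u v e], b as [u' v' e']; simpl; intros -> ->.
now rewrite (proof_irrelevance _ e e').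
Qed.

Lemma arrow_id_square (C : Category) (f : arrow C) :
  mor f ∘ idm (src f) = idm (tgt f) ∘ mor f.
Proof. now rewrite comp_idl, comp_idr. Qed.

Lemma arrow_comp_square (C : Category) (f g h : arrow C)
    (b : arrow_hom g h) (a : arrow_hom f g) :
  mor h ∘ (top b ∘ top a) = (bot b ∘ bot a) ∘ mor f.
Proof. now rewrite comp_assoc, square, <- comp_assoc, square, comp_assoc. Qed.

Definition arrow_id (C : Category) (f : arrow C) : arrow_hom f f :=
  MkArrowHom (arrow_id_square f).

Definition arrow_comp (C : Category) (f g h : arrow C)
    (b : arrow_hom g h) (a : arrow_hom f g) : arrow_hom f h :=
  MkArrowHom (arrow_comp_square b a).

Definition Arr (C : Category) : Category :=
  {| Ob := arrow C;
     Hom := @arrow_hom C;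
     idm := @arrow_id C;
     comp := @arrow_comp C;
     comp_idl := fun f g a => @arrow_hom_eq C f g (arrow_comp (arrow_id g) a) a
                                (comp_idl (top a)) (comp_idl (bot a));
     comp_idr := fun f g a => @arrow_hom_eq C f g (arrow_comp a (arrow_id f)) a
                                (comp_idr (top a)) (comp_idr (bot a));
     comp_assoc := fun f g h k c b a =>
       @arrow_hom_eq C f k (arrow_comp c (arrow_comp b a))
         (arrow_comp (arrow_comp c b) a)
         (comp_assoc (top c) (top b) (top a))
         (comp_assoc (bot c) (bot b) (bot a)) |}.

Definition mor_class (C : Category) : Type := forall A B : C, Hom A B -> Prop.

Definition replete (C : Category) (M : mor_class C) : Prop :=
  (forall A : C, M A A (idm A)) /\
  (forall (A' A B : C) (f : Hom A B) (u : Hom A' A),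
      is_iso u -> M A B f -> M A' B (f ∘ u)) /\
  (forall (A B B' : C) (f : Hom A B) (v : Hom B B'),
      is_iso v -> M A B f -> M A B' (v ∘ f)).

(* Reflectivity is only defined for replete classes, so repleteness is part of
   the predicate. *)
Definition reflective_class (C : Category) (M : mor_class C) : Prop :=
  replete M /\ reflective_sub (C := Arr C) (fun f => M _ _ (mor f)).

Definition op_class (C : Category) (M : mor_class C) : mor_class (op C) :=
  fun A B f => M B A f.

Definition coreflective_class (C : Category) (M : mor_class C) : Prop :=
  reflective_class (op_class M).

Definition NMono (C : Category) : mor_class C := @normal_mono C.

Definition NEpi (C : Category) : mor_class C := @normal_epi C.

Arguments NMono : clear implicits.
Arguments NEpi : clear implicits.

(* Main.v *)
Require Import Defs.
From Stdlib Require Import List FinFun ClassicalEpsilon FunctionalExtensionality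
  PropExtensionality.

(** A morphism is a normal monomorphism exactly when it is the pullback of some
    point [1 -> Q] (any such [Q] can be replaced by the pushout [B +_A 1], which
    maps to it).  Hence [nu_f] is a normal monomorphism, and in particular monic.
    Given a square [<u,v>] from [f] to a pullback [g] of [1 -> Q], the map [B -> Q]
    sends [f] to the point, so it extends to [B +_A 1]; therefore it also sends
    [nu_f] to the point, and [v ∘ nu_f] factors through [g].  So [<fhat, id>] is
    the reflection of [f].  Normal epimorphisms are the normal monomorphisms of
    the opposite category. *)

Set Implicit Arguments.
Unset Strict Implicit.
Unset Printing Implicit Defensive.

Local Open Scope cat_scope.

(** * Left adjoints from universal arrows *)

Definition universal_arrow (C D : Category) (G : Functor D C) (X : C) (Y : D)
    (eta : Hom X (G Y)) : Prop :=
  forall (Y' : D) (f : Hom X (G Y')),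
    exists! h : Hom Y Y', fmap G h ∘ eta = f.

(** Choice turns the merely existing universal arrows and their lifts into data. The functor laws,
    naturality and the triangle identities then follow from the equation that defines a lift and
    from its uniqueness. *)
Lemma left_adjoint_of_universal_arrows (C D : Category) (G : Functor D C) :
  (forall X : C, exists (Y : D) (eta : Hom X (G Y)), universal_arrow eta) ->
  has_left_adjoint G.
Proof.
intros H.
pose (F0 := fun X => proj1_sig (constructive_indefinite_description _ (H X))).
pose (E := fun X => constructive_indefinite_description _
  (proj2_sig (constructive_indefinite_description _ (H X)))).
pose (eta := fun X => proj1_sig (E X) : Hom X (G (F0 X))).
assert (U : forall X, universal_arrow (eta X)) by (intros X; exact (proj2_sig (E X))).
clearbody eta; clear E; clearbody F0.
pose (L := fun X Y f => constructive_indefinite_description _ (U X Y f)).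
pose (lift := fun X Y f => proj1_sig (L X Y f)).
assert (liftK : forall X Y (f : Hom X (G Y)), fmap G (lift X Y f) ∘ eta X = f)
  by (intros X Y f; exact (proj1 (proj2_sig (L X Y f)))).
clearbody lift; clear L.
(* Uniqueness in cancellable form: morphisms out of [F0 X] are tested on [eta X]. *)
assert (ext : forall X Y (h k : Hom (F0 X) Y),
  fmap G h ∘ eta X = fmap G k ∘ eta X -> h = k).
{ intros X Y h k e.
  destruct (U X Y (fmap G k ∘ eta X)) as [w [_ w_uniq]].
  now rewrite <- (w_uniq h e), <- (w_uniq k eq_refl). }
unshelve epose (F := @MkFunctor C D F0 (fun A B u => lift A (F0 B) (eta B ∘ u)) _ _).
{ intros A; apply ext; now rewrite liftK, fmap_id, comp_idl, comp_idr. }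
{ intros A B K g f; apply ext.
  now rewrite liftK, fmap_comp, <- comp_assoc, liftK, !comp_assoc, liftK. }
exists F; constructor.
refine (@MkAdjunction C D F G eta (fun Y => lift (G Y) Y (idm (G Y))) _ _ _ _);
  cbn.
- intros X X' u; apply liftK.
- intros Y Y' v; apply ext.
  now rewrite !fmap_comp, <- !comp_assoc, !liftK, comp_assoc, liftK, comp_idl,
    comp_idr.
- intros X; apply ext.
  now rewrite fmap_comp, <- comp_assoc, liftK, comp_assoc, liftK, fmap_id,
    !comp_idl.
- intros Y; apply liftK.
Qed.

(** * Finite limits and colimits in the opposite category *)

Definition op_functor (J C : Category) (F : Functor J (op C)) : Functor (op J) C :=
  @MkFunctor (op J) C (fobj F) (fun i j a => fmap F a)
    (fun i => fmap_id F i) (fun i j k b a => fmap_comp F a b).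

Lemma op_finite_category (J : Category) :
  finite_category J -> finite_category (op J).
Proof. intros [HO HH]; split; [exact HO | intros i j; exact (HH j i)]. Qed.

(** A cone over [F] in [op C] is, up to conversion, a cocone under [op_functor F] in [C], so the
    colimit data serve unchanged. *)
Lemma finitely_complete_op (C : Category) :
  finitely_cocomplete C -> finitely_complete (op C).
Proof.
intros H J F HJ.
destruct (H (op J) (op_functor F) (op_finite_category HJ)) as (L & p & pK & pU).
exists L, p; split.
- intros i j a; exact (pK j i a).
- intros X q qK; exact (pU X q (fun i j a => qK j i a)).
Qed.

Lemma finitely_cocomplete_op (C : Category) :
  finitely_complete C -> finitely_cocomplete (op C).
Proof.
intros H J F HJ.
destruct (H (op J) (op_functor F) (op_finite_category HJ)) as (L & p & pK & pU).
exists L, p; split.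
- intros i j a; exact (pK j i a).
- intros X q qK; exact (pU X q (fun i j a => qK j i a)).
Qed.

(** * Terminal objects and pullbacks as finite limits *)

Definition empty_category : Category.
Proof.
refine (@MkCategory Empty_set (fun _ _ => Empty_set) (fun A => A)
  (fun _ _ _ _ f => f) _ _ _); intros [].
Defined.

(** The limit of the empty diagram is terminal, since every object carries an empty cone. *)
Lemma exists_terminal (C : Category) :
  finitely_complete C -> exists T : C, is_terminal T.
Proof.
intros H.
unshelve epose (F := @MkFunctor empty_category C
  (fun A : Empty_set => match A with end)
  (fun A : Empty_set => match A with end) _ _); try (intros []).
destruct (H empty_category F) as (T & p & _ & U).
- split; [exists nil; intros [] | intros []].
- exists T; intros X.
  destruct (U X (fun j : Empty_set => match j with end)) as [h [_ hU]].
  + intros [].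
  + exists h; split; [exact I | intros k _; apply hU; intros []].
Qed.

Inductive cospan_ob : Type := cospan_left | cospan_right | cospan_apex.

Definition cospan_hom (i j : cospan_ob) : Type :=
  match i, j with
  | cospan_left, cospan_left | cospan_right, cospan_right | _, cospan_apex => unit
  | _, _ => Empty_set
  end.

Definition cospan : Category.
Proof.
refine (@MkCategory cospan_ob cospan_hom
  (fun i => match i with cospan_left | cospan_right | cospan_apex => tt end)
  (* The impossible cases eliminate whichever of the two arrows lies in [Empty_set]. *)
  (fun i j k => match i, j, k with
    | cospan_left, cospan_left, cospan_left
    | cospan_right, cospan_right, cospan_right
    | cospan_left, _, cospan_apex
    | cospan_right, _, cospan_apex
    | cospan_apex, _, cospan_apex => fun _ _ => tt
    | _, cospan_left, cospan_right => fun g _ => match g with end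
    | _, cospan_right, cospan_left => fun g _ => match g with end
    | _, cospan_apex, cospan_left => fun g _ => match g with end
    | _, cospan_apex, cospan_right => fun g _ => match g with end
    | cospan_right, cospan_left, cospan_left => fun _ f => match f with end
    | cospan_apex, cospan_left, cospan_left => fun _ f => match f with end
    | cospan_left, cospan_right, cospan_right => fun _ f => match f with end
    | cospan_apex, cospan_right, cospan_right => fun _ f => match f with end
    end) _ _ _).
- intros [] [] []; reflexivity.
- intros [] [] []; reflexivity.
- intros [] [] [] [] [] [] []; reflexivity.
Defined.

Lemma cospan_finite : finite_category cospan.
Proof.
split.
- exists (cospan_left :: cospan_right :: cospan_apex :: nil).
  intros []; simpl; auto.
- intros [] []; ((exists (tt :: nil); intros []; now left)
    || (exists nil; intros [])).
Qed.

Definition cospan_functor (C : Category) (X Y Z : C) (f : Hom X Z) (g : Hom Y Z) :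
  Functor cospan C.
Proof.
pose (F0 := fun i => match i with
  | cospan_left => X | cospan_right => Y | cospan_apex => Z end).
refine (@MkFunctor cospan C F0
  (fun i j => match i, j return cospan_hom i j -> Hom (F0 i) (F0 j) with
    | cospan_left, cospan_left => fun _ => idm X
    | cospan_right, cospan_right => fun _ => idm Y
    | cospan_apex, cospan_apex => fun _ => idm Z
    | cospan_left, cospan_apex => fun _ => f
    | cospan_right, cospan_apex => fun _ => g
    | _, _ => fun a => match a with end
    end) _ _).
- intros []; reflexivity.
- intros [] [] [] [] []; simpl; now rewrite ?comp_idl, ?comp_idr.
Defined.

Lemma exists_pullback (C : Category) (X Y Z : C) (f : Hom X Z) (g : Hom Y Z) :
  finitely_complete C ->
  exists (P : C) (p : Hom P X) (q : Hom P Y), is_pullback f g p q.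
Proof.
intros H.
destruct (H cospan (cospan_functor f g) cospan_finite) as (P & p & pK & pU).
exists P, (p cospan_left), (p cospan_right); split.
- pose proof (pK cospan_left cospan_apex tt) as e1.
  pose proof (pK cospan_right cospan_apex tt) as e2.
  simpl in e1, e2; congruence.
- intros W a b e.
  (* The apex leg of the cone is forced to be [f ∘ a], which equals [g ∘ b] by [e]. *)
  destruct (pU W (fun i : cospan => match i return Hom W (cospan_functor f g i) with
      | cospan_left => a | cospan_right => b | cospan_apex => f ∘ a end))
    as [h [hK hU]].
  + intros [] [] []; simpl; auto using comp_idl.
  + exists h; split; [split; [exact (hK cospan_left) | exact (hK cospan_right)] |].
    intros k [ka kb]; apply hU; intros []; [exact ka | exact kb |].
    pose proof (pK cospan_left cospan_apex tt) as e1; simpl in e1 |- *.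
    now rewrite <- e1, <- comp_assoc, ka.
Qed.

(** Being a pushout in [C] is convertible to being a pullback in [op C]. *)
Lemma exists_pushout (C : Category) (Z X Y : C) (f : Hom Z X) (g : Hom Z Y) :
  finitely_cocomplete C ->
  exists (Q : C) (i : Hom X Q) (j : Hom Y Q), is_pushout f g i j.
Proof.
intros H; exact (@exists_pullback (op C) X Y Z f g (finitely_complete_op H)).
Qed.

Lemma pullback_sym (C : Category) (X Y Z P : C)
    (f : Hom X Z) (g : Hom Y Z) (p : Hom P X) (q : Hom P Y) :
  is_pullback f g p q -> is_pullback g f q p.
Proof.
intros [e U]; split; [now symmetry |].
intros W a b eab; destruct (U W b a (eq_sym eab)) as [h [[h1 h2] hU]].
exists h; split; [now split | intros k []; now apply hU].
Qed.

Lemma pushout_sym (C : Category) (Z X Y Q : C)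
    (f : Hom Z X) (g : Hom Z Y) (i : Hom X Q) (j : Hom Y Q) :
  is_pushout f g i j -> is_pushout g f j i.
Proof. exact (@pullback_sym (op C) X Y Z Q f g i j). Qed.

(** * Pullbacks of a point [1 -> Q] *)

Lemma terminal_eq (C : Category) (T X : C) (a b : Hom X T) :
  is_terminal T -> a = b.
Proof.
intros HT; destruct (HT X) as [t [_ tU]].
now rewrite <- (tU a I), <- (tU b I).
Qed.

(** Leaving [Q] arbitrary lets repleteness be checked without recomputing pushouts. *)
Definition point_pullback (C : Category) (A B : C) (f : Hom A B) : Prop :=
  exists (T Q : C) (i : Hom B Q) (j : Hom T Q) (t : Hom A T),
    is_terminal T /\ is_pullback i j f t.

(** A map into the pullback is determined by its component in [B], as the other component lands in a
    terminal object. *)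
Lemma point_pullback_monic (C : Category) (A B W : C) (f : Hom A B) (a b : Hom W A) :
  point_pullback f -> f ∘ a = f ∘ b -> a = b.
Proof.
intros (T & Q & i & j & t & HT & e & U) eab.
destruct (U W (f ∘ a) (t ∘ a)) as [h [_ hU]].
{ now rewrite !comp_assoc, e. }
rewrite <- (hU a (conj eq_refl eq_refl)); apply hU; split; [now symmetry |].
now apply terminal_eq.
Qed.

Lemma point_pullback_precomp_iso (C : Category) (A' A B : C) (f : Hom A B)
    (u : Hom A' A) :
  is_iso u -> point_pullback f -> point_pullback (f ∘ u).
Proof.
intros (u' & u'u & uu') (T & Q & i & j & t & HT & e & U).
exists T, Q, i, j, (t ∘ u); split; [exact HT | split].
- now rewrite !comp_assoc, e.
- intros W a b eab; destruct (U W a b eab) as [h [[ha hb] hU]].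
  exists (u' ∘ h); split; [split |].
  + now rewrite <- comp_assoc, (comp_assoc u), uu', comp_idl.
  + now apply terminal_eq.
  + intros k [ka kb].
    rewrite (hU (u ∘ k)), comp_assoc, u'u, comp_idl; [reflexivity | split].
    * now rewrite comp_assoc.
    * now rewrite comp_assoc.
Qed.

Lemma point_pullback_postcomp_iso (C : Category) (A B B' : C) (f : Hom A B)
    (v : Hom B B') :
  is_iso v -> point_pullback f -> point_pullback (v ∘ f).
Proof.
intros (v' & v'v & vv') (T & Q & i & j & t & HT & e & U).
(* The point stays the same; only the map to [Q] is transported along the inverse of [v]. *)
exists T, Q, (i ∘ v'), j, t; split; [exact HT | split].
- now rewrite <- comp_assoc, (comp_assoc v'), v'v, comp_idl.
- intros W a b eab; destruct (U W (v' ∘ a) b) as [h [[ha hb] hU]].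
  { now rewrite comp_assoc. }
  exists h; split; [split; [| exact hb] |].
  + now rewrite <- comp_assoc, ha, comp_assoc, vv', comp_idl.
  + intros k [ka kb]; apply hU; split; [| exact kb].
    now rewrite <- ka, <- comp_assoc, comp_assoc, v'v, comp_idl.
Qed.

(** Taking [Q] to be [T] itself makes the point an identity, whose pullback along [A -> T] is the
    identity of [A]. *)
Lemma point_pullback_id (C : Category) (A : C) :
  finitely_complete C -> point_pullback (idm A).
Proof.
intros H; destruct (exists_terminal H) as [T HT].
destruct (HT A) as [t _].
exists T, T, t, (idm T), t; split; [exact HT | split].
- now rewrite comp_idl, comp_idr.
- intros W a b _; exists a; split; [split; [apply comp_idl | now apply terminal_eq] |].
  intros k [ka _]; now rewrite <- ka, comp_idl.
Qed.

Lemma normal_mono_point_pullback (C : Category) (A B : C) (f : Hom A B) :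
  normal_mono f -> point_pullback f.
Proof.
intros (N & nu & fhat & (T & Q & t & i & j & s & HT & _ & P) & ef & Hiso).
rewrite <- ef; apply point_pullback_precomp_iso; [exact Hiso |].
now exists T, Q, i, j, s.
Qed.

(** The square of [f] is already a pullback over the pushout [Q'], so [f] serves as its own [nu],
    with [fhat] the identity. *)
Lemma point_pullback_normal_mono (C : Category) (A B : C) (f : Hom A B) :
  finitely_cocomplete C -> point_pullback f -> normal_mono f.
Proof.
intros H (T & Q & i & j & t & HT & e & U).
destruct (exists_pushout f t H) as (Q' & i' & j' & e' & U').
exists A, f, (idm A); split; [| split].
- exists T, Q', t, i', j', t; split; [exact HT | split; [now split |]].
  split; [exact e' |].
  intros W a b eab; apply U.
  (* The comparison [h : Q' -> Q] turns a cone over [i'] and [j'] into one over [i] and [j]. *)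
  destruct (U' Q i j e) as [h [[<- <-] _]].
  now rewrite <- !comp_assoc, eab.
- apply comp_idr.
- exists (idm A); split; apply comp_idl.
Qed.

Lemma NMono_replete (C : Category) :
  finitely_complete C -> finitely_cocomplete C -> replete (NMono C).
Proof.
intros hlim hcolim; split; [| split].
- intros A; apply point_pullback_normal_mono; [exact hcolim |].
  now apply point_pullback_id.
- intros A' A B f u Hu Hf; apply point_pullback_normal_mono; [exact hcolim |].
  apply point_pullback_precomp_iso; [exact Hu |].
  now apply normal_mono_point_pullback.
- intros A B B' f v Hv Hf; apply point_pullback_normal_mono; [exact hcolim |].
  apply point_pullback_postcomp_iso; [exact Hv |].
  now apply normal_mono_point_pullback.
Qed.

(** * Normal images and the reflection *)

Lemma normal_image_lift (C : Category) (A B N A' B' : C) (f : Hom A B)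
    (nu : Hom N B) (g : Hom A' B') (u : Hom A A') (v : Hom B B') :
  is_normal_image f nu -> point_pullback g -> g ∘ u = v ∘ f ->
  exists w : Hom N A', g ∘ w = v ∘ nu.
Proof.
intros (T & Q & t & i & j & s & HT & [_ UQ] & eN & _)
  (T' & Q' & i' & j' & t' & HT' & e' & U') sq.
(* The two squares may use different terminal objects; [c] compares them. *)
destruct (HT' T) as [c _].
destruct (UQ Q' (i' ∘ v) (j' ∘ c)) as [h [[hi hj] _]].
{ rewrite <- comp_assoc, <- sq, comp_assoc, e', <- !comp_assoc.
  f_equal; now apply terminal_eq. }
(* Since [h] extends [i' ∘ v] and [j' ∘ c], applying it to [eN] shows that [v ∘ nu] lies over the
   point [j']. *)
destruct (U' N (v ∘ nu) (c ∘ s)) as [w [[wK _] _]].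
{ now rewrite !comp_assoc, <- hi, <- hj, <- !comp_assoc, eN. }
now exists w.
Qed.

Lemma exists_normal_image (C : Category) (A B : C) (f : Hom A B) :
  finitely_complete C -> finitely_cocomplete C ->
  exists (N : C) (nu : Hom N B) (fhat : Hom A N),
    is_normal_image f nu /\ nu ∘ fhat = f.
Proof.
intros hlim hcolim.
destruct (exists_terminal hlim) as [T HT].
destruct (HT A) as [t _].
destruct (exists_pushout f t hcolim) as (Q & i & j & HQ).
destruct (exists_pullback i j hlim) as (N & nu & s & HN).
destruct (proj2 HN A f t (proj1 HQ)) as [fhat [[fK _] _]].
exists N, nu, fhat; split; [| exact fK].
now exists T, Q, t, i, j, s.
Qed.

Lemma NMono_reflective (C : Category) :
  finitely_complete C -> finitely_cocomplete C -> reflective_class (NMono C).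
Proof.
intros hlim hcolim; split; [now apply NMono_replete |].
apply left_adjoint_of_universal_arrows; intros [A B f].
destruct (exists_normal_image f hlim hcolim) as (N & nu & fhat & HN & fK).
assert (Hnu : NMono C N B nu).
{ apply point_pullback_normal_mono; [exact hcolim |].
  destruct HN as (T & Q & t & i & j & s & HT & _ & P); now exists T, Q, i, j, s. }
assert (sq : nu ∘ fhat = idm B ∘ f) by now rewrite comp_idl.
exists (exist _ (MkArrow nu) Hnu).
exists (@MkArrowHom C (MkArrow f) (MkArrow nu) fhat (idm B) sq).
intros [[A' B' g] Hg] [u v uv]; simpl in *.
pose proof (normal_mono_point_pullback Hg) as Pg.
destruct (normal_image_lift HN Pg uv) as [w wK].
exists (@MkArrowHom C (MkArrow nu) (MkArrow g) w v wK); split.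
(* The top components need only be compared after composing with the monic [g]. *)
- apply arrow_hom_eq; simpl; [| apply comp_idr].
  apply (point_pullback_monic Pg).
  now rewrite comp_assoc, wK, <- comp_assoc, fK.
(* The bottom component of the unit is an identity, which forces [v'] to be [v]; the top is then
   forced because [g] is monic. *)
- intros [w' v' wK'] e; simpl in *.
  pose proof (f_equal (fun a => bot a) e) as ev; simpl in ev.
  rewrite comp_idr in ev; subst v'.
  apply arrow_hom_eq; simpl; [| reflexivity].
  apply (point_pullback_monic Pg); now rewrite wK, wK'.
Qed.

(** * Normal epimorphisms by duality *)

Lemma normal_epi_op (C : Category) (A B : C) (f : Hom A B) :
  normal_epi f <-> @normal_mono (op C) B A f.
Proof.
split.
- intros (P & p & fc & (I & K & z & k & l & s & HI & HK & HP) & ef & g & e1 & e2).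
  exists P, p, fc; split; [| split; [exact ef | now exists g]].
  exists I, K, z, l, k, s; split; [exact HI | split].
  (* [is_normal_coimage] lists the leg through the initial object first, while [is_normal_image]
     lists the terminal one second; hence the symmetries. *)
  + exact (pullback_sym HK).
  + exact (pushout_sym HP).
- intros (P & p & fc & (I & K & z & l & k & s & HI & HK & HP) & ef & g & e1 & e2).
  exists P, p, fc; split; [| split; [exact ef | now exists g]].
  exists I, K, z, k, l, s; split; [exact HI | split].
  + exact (pushout_sym HK).
  + exact (pullback_sym HP).
Qed.

(** Stated as an equality of classes, so that it can rewrite inside [reflective_class], where the
    class occurs in the type of objects of a subcategory. *)
Lemma NEpi_op (C : Category) : op_class (NEpi C) = NMono (op C).
Proof.
extensionality A; extensionality B; extensionality f.
apply propositional_extensionality; apply normal_epi_op.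
Qed.

Theorem theorem3p2 (C : Category)
    (hlim : finitely_complete C) (hcolim : finitely_cocomplete C) :
  reflective_class (NMono C) /\ coreflective_class (NEpi C).
Proof.
split; [now apply NMono_reflective |].
unfold coreflective_class; rewrite NEpi_op; apply NMono_reflective.
- now apply finitely_complete_op.
- now apply finitely_cocomplete_op.
Qed.
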